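(* Let $(M,\mathcal D,g)$ be an equinilpotentisable sub-Riemannian manifold with nilpotent model $N$ and symmetry group $H$, let $k_1$ be the rank of $\mathcal D$, and let $\omega$ be an adapted Cartan connection on the graded frame bundle $\mathcal O_H(\mathcal D)$. Let $\frac12\Delta$ be the generator of the stochastic process on $M$ obtained as the stochastic development, with respect to $\omega$, of the canonical sub-Riemannian diffusion on $N$. Then, in any local trivialisation of $\mathcal O_H(\mathcal D)$ with corresponding local orthonormal frame $X=(X_1,\dots,X_{k_1})^T$ of $\mathcal D$, and in terms of the reduced vectors $\Gamma^\alpha$ of Christoffel symbols with respect to a basis $\{A_\alpha: 1\le \alpha\le\dim H\}$ of $\mathfrak h$, $$\Delta=\sum_{i=1}^{k_1}X_i^2+\sum_{\alpha=1}^{\dim H}(\Gamma^\alpha)^T A_\alpha X .$$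
   Context: **Sub-Riemannian manifolds.** A sub-Riemannian manifold $(M,\mathcal D,g)$ is a smooth $n$-dimensional manifold $M$ with a bracket generating distribution $\mathcal D\subset TM$ and a metric $g$ on $\mathcal D$. Put $\mathcal D^{0}=0$, $\mathcal D^{-1}=\mathcal D$, $\mathcal D^{-(i+1)}_q=\mathcal D^{-i}_q+[\mathcal D,\mathcal D^{-i}]_q$, let $m$ (the step) be minimal with $\mathcal D^{-m}=TM$, and $\mathrm{gr}(T_qM)=\bigoplus_{i=1}^m \mathcal D_q^{-i}/\mathcal D_q^{-(i-1)}$. The Lie bracket of vector fields induces on $\mathrm{gr}(T_qM)$ the structure of a graded nilpotent Lie algebra, and $g$ gives an inner product on its part $\mathcal D_q^{-1}$. This extends to an inner product on $\mathrm{gr}(T_qM)$ with pairwise orthogonal layers: $\mathcal D_q^{-l}/\mathcal D_q^{-(l-1)}$ is identified with $(\ker\pi_l)^\perp\subset\bigotimes^l\mathcal D_q$ where $\pi_l(v_1\otimes\dots\otimes v_l)=[v_1,[v_2,\dots,[v_{l-1},v_l]\dots]]$ (brackets in $\mathrm{gr}(T_qM)$). $(M,\mathcal D,g)$ is equinilpotentisable if all $\mathrm{gr}(T_qM)$, $q\in M$, are isomorphic as graded metric Lie algebras. The common model is denoted $\mathfrak n=\mathfrak n_{-1}\oplus\dots\oplus\mathfrak n_{-m}$, with inner product $g_{-1}$ on $\mathfrak n_{-1}$, and the nilpotent model $N$ is the simply connected Lie group with Lie algebra $\mathfrak n$. Fix an orthonormal basis $e_1,\dots,e_n$ of $\mathfrak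 n$ adapted to the grading (so $e_1,\dots,e_{k_1}$ is an orthonormal basis of $\mathfrak n_{-1}$). An adapted frame is a local frame $(X_1,\dots,X_n)$ of $TM$ such that $X_1,\dots,X_{\dim\mathcal D^{-i}}$ span $\mathcal D^{-i}$ for each $i$. **Symmetry group and frame bundle.** The symmetry group $H$ is the Lie group of automorphisms of the graded Lie algebra $\mathfrak n$ preserving $g_{-1}$, viewed as a group of orthogonal $k_1\times k_1$ matrices through its action on $\mathfrak n_{-1}$ in the basis $e_1,\dots,e_{k_1}$. Its Lie algebra $\mathfrak h$ consists of the graded derivations of $\mathfrak n$ that are skew on $\mathfrak n_{-1}$; let $\mathfrak g=\mathfrak n\oplus\mathfrak h$ be the semi-direct product with $[A,v]=A(v)$ for $A\in\mathfrak h$, $v\in\mathfrak n$. The bundle $\mathcal O_H(\mathcal D)\to M$ is the right principal $H$-bundle of graded Lie algebra isomorphisms $f:\mathfrak n\to\mathrm{gr}(T_qM)$ isometric on $\mathfrak n_{-1}$, with projection $\pi$. A local section $s$ is called a local trivialisation; it determines the orthonormal frame $X_i=s(e_i)$, $1\le i\le k_1$, of $\mathcal D$, and a point $s(q)h$ is written $(h,q)$. **Cartan connections.** A Cartan connection on $\mathcal O_H(\mathcal D)$ modelled on $(\mathfrak g,\mathfrak h)$ is a $\mathfrak g$-valued one-form $\omega$ on $\mathcal O_H(\mathcal D)$ such that each $\omega_p:T_p\mathcal O_H(\mathcal D)\to\mathfrak g$ is an isomorphism, $R_h^*\omega=\mathrm{Ad}_{h^{-1}}\omega$ for $h\in H$,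 and $\omega(A^* )=A$ for the fundamental vector field $A^*$ of every $A\in\mathfrak h$. Write $\omega=\omega_{\mathfrak n}+\omega_{\mathfrak h}$. It is adapted if for each local section $s$ the components $\theta^1_{\mathfrak n},\dots,\theta_{\mathfrak n}^n$ of $\theta_{\mathfrak n}=s^*\omega_{\mathfrak n}$ form a coframe dual to an adapted frame $(\tilde X_1,\dots,\tilde X_n)$ compatible with $s$, i.e. $\tilde X_i\equiv s(e_i)$ modulo $\mathcal D^{-(l-1)}$ whenever $e_i\in\mathfrak n_{-l}$ (in particular $\tilde X_i=X_i$ for $i\le k_1$). For a basis $\{A_\alpha\}$ of $\mathfrak h$, the Christoffel symbols $\Gamma_i^\alpha$ are defined by $s^*\omega_{\mathfrak h}=\sum_\alpha A_\alpha\sum_{i=1}^n\Gamma_i^\alpha\theta_{\mathfrak n}^i$, and $\Gamma^\alpha=(\Gamma_1^\alpha,\dots,\Gamma_{k_1}^\alpha)^T$. In matrix formulae $A_\alpha$ denotes the $k_1\times k_1$ matrix of its action on $\mathfrak n_{-1}$, i.e. $A_\alpha e_i=\sum_j (A_\alpha)^j_{\;i}e_j$ with row index $j$ and column index $i$. **Stochastic development.** The canonical sub-Riemannian diffusion on $N$ is the lift to $N$ of a standard Brownian motion $b$ on $\mathbb R^{k_1}$; its generator is $\frac12\sum_{i=1}^{k_1}V_i^2$ with $V_i$ the left-invariant vector field on $N$ corresponding to $e_i$. Its stochastic development with respect to an adapted Cartan connection $\omega$ is the process $\gamma_M$ on $M$ which is the projection to $M$ of the unique solution of the system of Stratonovich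 stochastic differential equations, written in a local trivialisation with $\tilde h=h^{-1}$, $$\partial\gamma_M=\partial b^T\,\tilde h\,X(\gamma_M),\qquad \partial\tilde h=\sum_{\alpha=1}^{\dim H}\big(\partial b^T\,\tilde h\,\Gamma^\alpha(\gamma_M)\big)Y_\alpha(\tilde h),$$ subject to a choice of initial condition, where $Y_\alpha(\tilde h)=\tilde hA_\alpha$ is the left-invariant vector field on $H$ corresponding to $A_\alpha$. The generator of a solution of $\partial z_t=\sum_iZ_i(z_t)\,\partial b_t^i$ is $\frac12\sum_iZ_i^2$; the generator of the projected process is obtained by applying it to functions pulled back from $M$. *)

(* Defs.v *)
From mathcomp Require Import all_boot all_order all_algebra.
From mathcomp Require Import all_classical all_reals all_analysis.
Set Implicit Arguments.
Unset Strict Implicit.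
Unset Printing Implicit Defensive.
Import Order.TTheory GRing.Theory Num.Theory.
Import numFieldNormedType.Exports.
Local Open Scope classical_set_scope.
Local Open Scope ring_scope.

Fixpoint Ck (R : realType) (N : nat) (V : normedModType R) (k : nat)
    (W : set 'cV[R]_N) (g : 'cV[R]_N -> V) : Prop :=
  match k with
  | 0%N => forall x, W x -> {for x, continuous g}
  | k'.+1 => (forall x, W x -> differentiable g x) /\
             (forall v : 'cV[R]_N, Ck k' W ('D_v g))
  end.

Definition smooth_on (R : realType) (N : nat) (V : normedModType R)
    (W : set 'cV[R]_N) (g : 'cV[R]_N -> V) : Prop :=
  open W /\ forall k, Ck k W g.

Record chart (R : realType) (n : nat) (M : topologicalType) := Chart {
  dom : set M;
  fwd : M -> 'cV[R]_n;
  bwd : 'cV[R]_n -> M;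
  dom_open : open dom;
  cod_open : open (fwd @` dom);
  fwdK : forall q, dom q -> bwd (fwd q) = q;
  fwd_cont : forall q, dom q -> {for q, continuous fwd};
  bwd_cont : forall x, (fwd @` dom) x -> {for x, continuous bwd} }.

(* The atlas is a family of charts indexed by the points, the chart of index q
   being a chart around q; every smooth structure has an atlas of this form.
   A tangent vector at q is represented by its coordinates in the chart of
   index q, so that T_qM is 'cV[R]_n for every q. *)
Record manifold (R : realType) (n : nat) := Manifold {
  carrier :> topologicalType;
  carrier_hausdorff : hausdorff_space carrier;
  carrier_second_countable : @second_countable carrier;
  chart_at : carrier -> chart R n carrier;
  chart_atP : forall q, dom (chart_at q) q;
  chart_compat : forall p q,
    smooth_on (fwd (chart_at p) @` (dom (chart_at p) `&` dom (chart_at q)))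
              (fwd (chart_at q) \o bwd (chart_at p)) }.

Section ManifoldCalculus.
Variables (R : realType) (n : nat) (M : manifold R n).
Implicit Types (p q : M) (U : set M) (X Y : M -> 'cV[R]_n).

Definition phi q : M -> 'cV[R]_n := fwd (chart_at q).
Definition psi q : 'cV[R]_n -> M := bwd (chart_at q).

(* coordinates, in the chart of index q, of the vector v of T_pM *)
Definition tcoord q p (v : 'cV[R]_n) : 'cV[R]_n :=
  'D_v (phi q \o psi p) (phi p p).

Definition smooth_fun U (f : M -> R) : Prop :=
  forall q, smooth_on (phi q @` (U `&` dom (chart_at q)))
                      (f \o psi q : 'cV[R]_n -> R^o).

Definition vf_rep q X (x : 'cV[R]_n) : 'cV[R]_n :=
  tcoord q (psi q x) (X (psi q x)).

Definition smooth_vf U X : Prop :=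
  forall q, smooth_on (phi q @` (U `&` dom (chart_at q))) (vf_rep q X).

Definition vf_app X (f : M -> R) (q : M) : R :=
  'D_(X q) (f \o psi q : 'cV[R]_n -> R^o) (phi q q).

Definition lie X Y (q : M) : 'cV[R]_n :=
  'D_(X q) (vf_rep q Y) (phi q q) - 'D_(Y q) (vf_rep q X) (phi q q).

Definition section_of (S : M -> set 'cV[R]_n) U X : Prop :=
  smooth_vf U X /\ forall q, U q -> S q (X q).

(* A point over q of the bundle of k-tuples of tangent vectors is a matrix whose
   columns are vectors of T_qM. *)

Definition frame_coord k q (p : M * 'M[R]_(n, k)) : 'M[R]_(n, k) :=
  \matrix_(i, j) tcoord q p.1 (col j p.2) i ord0.

Definition smooth_plot k N (V : set 'cV[R]_N)
    (sigma : 'cV[R]_N -> M * 'M[R]_(n, k)) : Prop :=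
  [/\ open V,
      forall x, V x -> {for x, continuous (fst \o sigma)},
      forall q, smooth_on [set x | V x /\ dom (chart_at q) (sigma x).1]
                          (phi q \o (fst \o sigma)) &
      forall q, smooth_on [set x | V x /\ dom (chart_at q) (sigma x).1]
                          (frame_coord q \o sigma)].

(* derivative of sigma at x in the direction v; the result is a tangent vector
   at sigma x, in the coordinates induced by the chart of index (sigma x).1 *)
Definition vel k N (sigma : 'cV[R]_N -> M * 'M[R]_(n, k))
    (x v : 'cV[R]_N) : 'cV[R]_n * 'M[R]_(n, k) :=
  ('D_v (phi (sigma x).1 \o (fst \o sigma)) x,
   'D_v (frame_coord (sigma x).1 \o sigma) x).

End ManifoldCalculus.

Definition lin_span (R : realType) n (S : set 'cV[R]_n) : set 'cV[R]_n :=
  [set v | exists N (c : 'I_N -> R) (w : 'I_N -> 'cV[R]_n),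
     (forall i, S (w i)) /\ v = \sum_i c i *: w i].

(* [v_1, [v_2, ... [v_(l-1), v_l] ... ]] *)
Fixpoint nested (I T : Type) (z : T) (b : T -> T -> T) (v : I -> T)
    (s : seq I) : T :=
  match s with
  | [::] => z
  | [:: i] => v i
  | i :: s' => b (v i) (nested z b v s')
  end.

Section LayerInnerProduct.
Variables (R : realType) (k n l : nat).

(* An element of the l-th tensor power of a k-dimensional Euclidean space, by
   its coordinates in the basis induced by an orthonormal basis. *)
Definition tensor := {ffun l.-tuple 'I_k -> R}.

Definition tdot (S T : tensor) : R := \sum_I S I * T I.

(* P I is a representative of the bracket of the basis vectors of indices I,
   and W the subspace modulo which it is defined. *)
Variables (P : l.-tuple 'I_k -> 'cV[R]_n) (W : set 'cV[R]_n).

Definition tproj (T : tensor) : 'cV[R]_n := \sum_I T I *: P I.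

Definition ker_perp (S : tensor) : Prop :=
  forall T, W (tproj T) -> tdot S T = 0.

(* rho is the inner product of the classes of x and y modulo W, for the
   identification of the image of tproj with the orthogonal of its kernel *)
Definition layer_inner (x y : 'cV[R]_n) (rho : R) : Prop :=
  exists S T, [/\ ker_perp S, ker_perp T,
    W (x - tproj S), W (y - tproj T) & rho = tdot S T].

End LayerInnerProduct.

Section Flag.
Variables (R : realType) (n : nat) (M : manifold R n).
Variable D : M -> {vspace 'cV[R]_n}.

(* flag D i is the distribution of index -i of the filtration generated by D *)
Fixpoint flag (i : nat) : M -> set 'cV[R]_n :=
  match i with
  | 0%N => fun _ => [set 0]
  | 1%N => fun q => [set v | v \in D q]
  | i'.+1 => fun q => lin_span (flag i' q `|` [set v | exists U X Y,
      [/\ open U, U q, section_of (fun p => [set w | w \in D p]) U X,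
          section_of (flag i') U Y & v = lie X Y q]])
  end.

End Flag.

Record subRiemannian (R : realType) (k r : nat) := SubRiemannian {
  base :> manifold R (k + r);
  distr : base -> {vspace 'cV[R]_(k + r)};
  metric : base -> 'cV[R]_(k + r) -> 'cV[R]_(k + r) -> R;
  distr_smooth : forall q, exists U (X : 'I_k -> base -> 'cV[R]_(k + r)),
    [/\ open U, U q, forall i, smooth_vf U (X i) &
        forall p, U p -> basis_of (distr p) [tuple X i p | i < k]];
  distr_generating : forall q, exists l, flag distr l q = setT;
  metric_linear : forall q a u v w,
    u \in distr q -> v \in distr q -> w \in distr q ->
    metric q (a *: u + v) w = a * metric q u w + metric q v w;
  metric_sym : forall q u v, u \in distr q -> v \in distr q ->
    metric q u v = metric q v u;
  metric_pos : forall q u, u \in distr q -> u != 0 -> 0 < metric q u u;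
  metric_smooth : forall U X Y, open U ->
    section_of (flag distr 1) U X -> section_of (flag distr 1) U Y ->
    smooth_fun U (fun q => metric q (X q) (Y q)) }.

(* Graded metric Lie algebras have as underlying space that of the coordinates
   in an orthonormal basis e_1, ..., e_n adapted to the grading, where n = k + r
   and k is the dimension of the layer of index -1; in particular the inner
   product of that layer is the standard one in the first k coordinates. *)

Definition elayer (R : realType) n (wt : 'I_n -> nat) (l : nat) :
    set 'cV[R]_n :=
  [set x | forall i, wt i <> l -> x i ord0 = 0].

Definition ebasis (R : realType) n (i : 'I_n) : 'cV[R]_n := delta_mx i ord0.

Record gradedLie (R : realType) (k r : nat) := GradedLie {
  (* the i-th basis vector lies in the layer of index -(wt i) *)
  wt : 'I_(k + r) -> nat;
  br : 'cV[R]_(k + r) -> 'cV[R]_(k + r) -> 'cV[R]_(k + r);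
  wt_gt0 : forall i, (0 < wt i)%N;
  wt_eq1 : forall i, wt i = 1%N <-> (i < k)%N;
  wt_le : forall i j : 'I_(k + r), (i <= j)%N -> (wt i <= wt j)%N;
  br_linear : forall a x y z, br (a *: x + y) z = a *: br x z + br y z;
  br_alt : forall x, br x x = 0;
  br_jacobi : forall x y z,
    br x (br y z) + br y (br z x) + br z (br x y) = 0;
  br_graded : forall a b x y,
    elayer wt a x -> elayer wt b y -> elayer wt (a + b) (br x y);
  basis_orthonormal : forall i j, wt i = wt j ->
    layer_inner
      (fun I : (wt i).-tuple 'I_k =>
         nested 0 br (fun a => ebasis R (lshift r a)) I)
      [set 0] (ebasis R i) (ebasis R j) (i == j)%:R }.

Section Model.
Variables (R : realType) (k r : nat) (nn : gradedLie R k r).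
Local Notation n := (k + r)%N.

Definition layer (l : nat) : set 'cV[R]_n := elayer (wt nn) l.

Definition model_inner (l : nat) (x y : 'cV[R]_n) (rho : R) : Prop :=
  layer_inner
    (fun I : l.-tuple 'I_k =>
       nested 0 (br nn) (fun a => ebasis R (lshift r a)) I)
    [set 0] x y rho.

(* Endomorphisms of the model are matrices acting on columns; the action of a
   graded one on the layer of index -1 is its upper left k x k block. *)
Definition graded (F : 'M[R]_n) : Prop :=
  forall l x, layer l x -> layer l (F *m x).

Definition symgroup : set 'M[R]_n := [set F |
  [/\ F \in unitmx, graded F,
      forall x y, F *m br nn x y = br nn (F *m x) (F *m y) &
      (ulsubmx F)^T *m ulsubmx F = 1%:M]].

Definition symalg : set 'M[R]_n := [set B |
  [/\ graded B,
      forall x y, B *m br nn x y = br nn (B *m x) y + br nn x (B *m y) &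
      (ulsubmx B)^T = - ulsubmx B]].

(* the symmetry group as a group of orthogonal k x k matrices *)
Definition symgroup1 : set 'M[R]_k := [set h |
  exists F, symgroup F /\ h = ulsubmx F].

Definition symalg_basis d (A : 'I_d -> 'M[R]_n) : Prop :=
  (forall a, symalg (A a)) /\
  (forall B, symalg B -> exists! c : {ffun 'I_d -> R}, B = \sum_a c a *: A a).

(* Elements of the semi-direct product of the model and symalg are pairs; this
   is the adjoint action of the inverse of h. *)
Definition Ad_inv (h : 'M[R]_n) (z : 'cV[R]_n * 'M[R]_n) :
    'cV[R]_n * 'M[R]_n :=
  (invmx h *m z.1, invmx h *m z.2 *m h).

End Model.

Section FrameBundle.
Variables (R : realType) (k r : nat).
Variables (M : subRiemannian R k r) (nn : gradedLie R k r).
Local Notation n := (k + r)%N.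
Local Notation flagM := (flag (@distr R k r M)).

(* A graded linear map from the model to gr(T_qM) is given by a lift F to T_qM:
   it maps x in the layer of index -l to the class of F x modulo
   flagM l.-1 q. The next predicate says that the map is an isomorphism of
   graded Lie algebras, the bracket of the classes of X q and Y q being the
   class of lie X Y q. Layers beyond the step vanish on both sides. *)
Definition gr_iso (q : M) (F : 'M[R]_n) : Prop :=
  [/\ forall l x, (0 < l)%N -> layer nn l x -> flagM l q (F *m x),
      forall l v, (0 < l)%N -> flagM l q v ->
        exists! x, layer nn l x /\ flagM l.-1 q (v - F *m x) &
      forall a b x y U X Y, (0 < a)%N -> (0 < b)%N ->
        layer nn a x -> layer nn b y -> open U -> U q ->
        section_of (flagM a) U X -> section_of (flagM b) U Y ->
        flagM a.-1 q (X q - F *m x) -> flagM b.-1 q (Y q - F *m y) ->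
        flagM (a + b).-1 q (lie X Y q - F *m br nn x y)].

(* inner product of the classes of x and y in the layer of index -l of
   gr(T_qM); brackets in gr(T_qM) are computed on extensions V *)
Definition gr_inner (q : M) (l : nat) (x y : 'cV[R]_n) (rho : R) : Prop :=
  exists U (V : 'I_k -> M -> 'cV[R]_n),
    [/\ open U, U q, forall i, section_of (flagM 1) U (V i),
        forall i j, metric q (V i q) (V j q) = (i == j)%:R &
        layer_inner
          (fun I : l.-tuple 'I_k => nested (fun=> 0) (@lie R n M) V I q)
          (flagM l.-1 q) x y rho].

Definition gr_metric_iso (q : M) (F : 'M[R]_n) : Prop :=
  gr_iso q F /\
  (forall l x y rho, (0 < l)%N -> layer nn l x -> layer nn l y ->
     model_inner nn l x y rho <-> gr_inner q l (F *m x) (F *m y) rho).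

(* M is equinilpotentisable, with common model nn *)
Definition equinilpotentisable : Prop :=
  forall q : M, exists F, gr_metric_iso q F.

Definition isometric1 (q : M) (F : 'M[R]_n) : Prop :=
  forall i j : 'I_k,
    metric q (col (lshift r i) F) (col (lshift r j) F) = (i == j)%:R.

(* f is the isomorphism that F lifts; it is represented by its restriction u to
   the layer of index -1, where there is nothing to quotient by. As that layer
   generates the model, u determines f. *)
Definition lifts (p : M * 'M[R]_(n, k)) (F : 'M[R]_n) : Prop :=
  [/\ gr_iso p.1 F, isometric1 p.1 F & lsubmx F = p.2].

Definition frame_bundle : set (M * 'M[R]_(n, k)) := [set p |
  exists F, lifts p F].

Definition plot N (V : set 'cV[R]_N) (sigma : 'cV[R]_N -> M * 'M[R]_(n, k)) :=
  smooth_plot V sigma /\ forall x, V x -> frame_bundle (sigma x).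

Definition tangent (p : M * 'M[R]_(n, k)) : set ('cV[R]_n * 'M[R]_(n, k)) :=
  [set xi | exists N V (sigma : 'cV[R]_N -> M * 'M[R]_(n, k)) x v,
     [/\ plot V sigma, V x, sigma x = p & xi = vel sigma x v]].

Definition oneform := M * 'M[R]_(n, k) -> 'cV[R]_n * 'M[R]_(n, k) ->
  'cV[R]_n * 'M[R]_n.

(* The right action of h is (q, u) |-> (q, u h1), with h1 the k x k block of h;
   its differential is (v, w) |-> (v, w h1), and the fundamental vector field of
   B at (q, u) is (0, u B1). *)
Record cartan_connection (omega : oneform) : Prop := CartanConnection {
  omega_linear : forall p, frame_bundle p ->
    forall a xi eta, tangent p xi -> tangent p eta ->
      omega p (a *: xi + eta) = a *: omega p xi + omega p eta;
  omega_smooth : forall N V (sigma : 'cV[R]_N -> M * 'M[R]_(n, k)) v,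
    plot V sigma ->
    smooth_on V (fun x => (omega (sigma x) (vel sigma x v)).1) /\
    smooth_on V (fun x => (omega (sigma x) (vel sigma x v)).2);
  omega_values : forall p xi, frame_bundle p -> tangent p xi ->
    symalg nn (omega p xi).2;
  omega_iso : forall p, frame_bundle p ->
    forall z, symalg nn z.2 -> exists! xi, tangent p xi /\ omega p xi = z;
  omega_equivariant : forall p xi h, frame_bundle p -> tangent p xi ->
    symgroup nn h ->
    omega (p.1, p.2 *m ulsubmx h) (xi.1, xi.2 *m ulsubmx h) =
    Ad_inv h (omega p xi);
  omega_fundamental : forall p B, frame_bundle p -> symalg nn B ->
    omega p (0, p.2 *m ulsubmx B) = (0, B) }.

Definition local_section (U : set M) (s : M -> 'M[R]_(n, k)) : Prop :=
  [/\ open U, forall q, U q -> frame_bundle (q, s q) &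
      forall i, smooth_vf U (fun q => col i (s q))].

Definition pullback (s : M -> 'M[R]_(n, k)) (omega : oneform) (q : M)
    (v : 'cV[R]_n) : 'cV[R]_n * 'M[R]_n :=
  omega (q, s q) (vel (fun x => (psi q x, s (psi q x))) (phi q q) v).

Definition adapted_frame (U : set M) (X : 'I_n -> M -> 'cV[R]_n) : Prop :=
  (forall i, smooth_vf U (X i)) /\
  (forall q, U q ->
     free [tuple X i q | i < n] /\
     forall l v, flagM l q v <->
       exists c : 'I_n -> R, v = \sum_(i | (wt nn i <= l)%N) c i *: X i q).

Definition compatible (U : set M) (s : M -> 'M[R]_(n, k))
    (X : 'I_n -> M -> 'cV[R]_n) : Prop :=
  forall q, U q -> exists F, lifts (q, s q) F /\
    forall i, flagM (wt nn i).-1 q (X i q - F *m ebasis R i).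

Definition adapted (omega : oneform) : Prop :=
  forall U s, local_section U s ->
    exists X : 'I_n -> M -> 'cV[R]_n,
      [/\ adapted_frame U X, compatible U s X &
          forall q i j, U q ->
            (pullback s omega q (X j q)).1 i ord0 = (i == j)%:R].

Definition christoffel d (A : 'I_d -> 'M[R]_n) (omega : oneform) (U : set M)
    (s : M -> 'M[R]_(n, k)) (Gam : 'I_d -> 'I_n -> M -> R) : Prop :=
  forall q v, U q ->
    (pullback s omega q v).2 =
    \sum_a (\sum_i Gam a i q * (pullback s omega q v).1 i ord0) *: A a.

Definition reduced d (Gam : 'I_d -> 'I_n -> M -> R) (a : 'I_d) (q : M) :
    'cV[R]_k :=
  \col_i Gam a (lshift r i) q.

Definition frame_of (s : M -> 'M[R]_(n, k)) (i : 'I_k) (q : M) : 'cV[R]_n :=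
  col i (s q).

(* A vector field on the product of M and the space of k x k matrices, and its
   action on functions. The fields used below are tangent to the product of M
   and the symmetry group, a submanifold, so that acting there on a function
   only depends on its values on the submanifold. *)
Definition product_field := M * 'M[R]_k -> 'cV[R]_n * 'M[R]_k.

Definition product_app (Z : product_field) (F : M * 'M[R]_k -> R)
    (z : M * 'M[R]_k) : R :=
  'D_(Z z) (fun y : 'cV[R]_n * 'M[R]_k => F (psi z.1 y.1, y.2) : R^o)
           (phi z.1 z.1, z.2).

(* generator of the Stratonovich equation dz = \sum_i Z_i(z) db^i *)
Definition sde_generator (Z : 'I_k -> product_field) (F : M * 'M[R]_k -> R)
    (z : M * 'M[R]_k) : R :=
  2^-1 * \sum_i product_app (Z i) (product_app (Z i) F) z.

(* The coefficients of the equation of the development in the trivialisation s,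
   for the variables (gamma, h):
     d gamma = db^T h X(gamma),
     d h = \sum_a (db^T h Gam^a(gamma)) Y_a(h),   Y_a(h) = h A_a. *)
Definition development_sde d (A : 'I_d -> 'M[R]_n) (s : M -> 'M[R]_(n, k))
    (Gam : 'I_d -> 'I_n -> M -> R) (i : 'I_k) : product_field :=
  fun z => (\sum_j z.2 i j *: frame_of s j z.1,
            \sum_a (z.2 *m reduced Gam a z.1) i ord0 *:
              (z.2 *m ulsubmx (A a))).

(* L is the generator, over U, of the projection of the development to M: the
   generator of the development maps f \o fst to L f \o fst *)
Definition development_generator d (A : 'I_d -> 'M[R]_n) (U : set M)
    (s : M -> 'M[R]_(n, k)) (Gam : 'I_d -> 'I_n -> M -> R)
    (L : (M -> R) -> M -> R) : Prop :=
  forall f, smooth_fun setT f -> forall q h, U q -> symgroup1 nn h ->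
    sde_generator (development_sde A s Gam) (f \o fst) (q, h) = L f q.

End FrameBundle.

(* Main.v *)
From HB Require Import structures.
Require Import Defs.
From mathcomp Require Import all_boot all_order all_algebra.
From mathcomp Require Import all_classical all_reals all_analysis.
Set Implicit Arguments.
Unset Strict Implicit.
Unset Printing Implicit Defensive.
Import Order.TTheory GRing.Theory Num.Theory.
Import numFieldNormedType.Exports.
Local Open Scope classical_set_scope.
Local Open Scope ring_scope.

(** Let Z_i be the coefficient fields of the development in the variables
(gamma, h). On a function pulled back from the base only the base component
of Z_i acts, hence

  Z_i (f o pi) (q, h) = \sum_j h_ij (X_j f)(q)      [development_sde_app].

Applying Z_i again to this function, which is linear in h, the product rule
gives a term where the matrix component of Z_i replaces h and a term where its
base component differentiates X_j f                 [product_app_sum]: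

  Z_i^2 (f o pi) (q, h)
    = \sum_j (\sum_a (h Gam^a)_i (h A_a)_ij) X_j f (q)
      + \sum_j h_ij \sum_l h_il X_l (X_j f) (q).

Summing over i contracts h with its transpose, and h^T h = 1 since the symmetry
group acts by isometries on the first layer. The second term becomes
\sum_j X_j (X_j f) [sum_orthogonal] and the first one
\sum_a (Gam^a)^T A_a X f [sum_drift]. In particular the result does not depend
on h, so the projected process has a generator, and evaluating at h = 1
recovers it from the generator upstairs.

The analytic content is that X_j f is differentiable, so that its directional
derivatives are additive in the direction and obey the product rule
[vf_app_differentiable]. The difficulty is that (X f)(p) is computed in the
chart of index p, which varies with p; near q it has to be rewritten in the one
chart of index q [vf_app_chart, vf_app_near], where it is a polynomial in
coefficients of X and first partial derivatives of f. *)

(** * Differential calculus in normed spaces *)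

(** The first-order expansion at x only involves the germ of the function. *)
Lemma near_eq_differentiable (R : realType) (V W : normedModType R)
    (f g : V -> W) (x : V) :
  (\near x, f x = g x) -> differentiable f x -> differentiable g x.
Proof.
move=> fg df; have /diff_locallyP[dfc /eqaddoP dfo] := df.
have gE : g \o shift x = cst (g x) + 'd f x +o_ (0 : V) id.
  apply/eqaddoP => e e0.
  have fg0 : \forall y \near (0 : V), f (y + x) = g (y + x).
    by move: fg; rewrite (near_shift 0) subr0.
  near=> y.
  have -> : (g \o shift x - (cst (g x) + 'd f x)) y =
            (f \o shift x - (cst (f x) + 'd f x)) y.
    rewrite !fctE/= (nbhs_singleton fg); congr (_ - _).
    by apply/esym; near: y.
  by near: y; exact: dfo.
by apply/diff_locallyP; rewrite (diff_unique dfc gE).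
Unshelve. all: by end_near. Qed.

Lemma derive_lincomb (R : realType) (V W : normedModType R) k (g : V -> W)
    (x : V) (c : 'I_k -> R) (v : 'I_k -> V) :
  differentiable g x ->
  'D_(\sum_j c j *: v j) g x = \sum_j c j *: 'D_(v j) g x.
Proof.
move=> dg; rewrite deriveE// linear_sum/=.
by apply: eq_bigr => i _; rewrite linearZ deriveE.
Qed.

Lemma derive_sum_delta (R : realType) (N : nat) (W : normedModType R)
    (g : 'cV[R]_N -> W) (x v : 'cV[R]_N) :
  differentiable g x ->
  'D_v g x = \sum_i v i ord0 *: 'D_(delta_mx i ord0) g x.
Proof.
move=> dg; rewrite -derive_lincomb// {1}(matrix_sum_delta v).
by congr ('D_ _ _ _); apply: eq_bigr => i _; rewrite big_ord1.
Qed.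

Lemma is_derive_fst (R : realType) (V W E : normedModType R) (g : V -> E)
    (x v : V) (y w : W) :
  derivable g x v ->
  is_derive ((x, y) : V * W) (v, w) (g \o fst) ('D_v g x).
Proof. by move=> dg; split. Qed.

Lemma is_derive_snd (R : realType) (V W E : normedModType R) (g : W -> E)
    (x v : V) (y w : W) :
  derivable g y w ->
  is_derive ((x, y) : V * W) (v, w) (g \o snd) ('D_w g y).
Proof. by move=> dg; split. Qed.

Lemma is_derive_coord (R : realType) a b (m v : 'M[R]_(a, b)) i j :
  is_derive m v (fun N : 'M[R]_(a, b) => N i j : R^o) (v i j).
Proof.
split; first exact/diff_derivable/differentiable_coord.
rewrite deriveE; last exact: differentiable_coord.
have lin : linear (fun N : 'M[R]_(a, b) => N i j : R^o).
  by move=> c u w; rewrite !mxE.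
pose L : {linear 'M[R]_(a, b) -> R^o} :=
  HB.pack (fun N : 'M[R]_(a, b) => N i j : R^o)
          (GRing.isLinear.Build _ _ _ _ _ lin).
by rewrite -[fun _ => _]/(L : _ -> _) diff_lin//; exact: coord_continuous.
Qed.

(** * Vector fields acting on functions on a manifold *)

Section VectorFields.
Variables (R : realType) (n : nat) (M : manifold R n).
Implicit Types (p q : M) (U : set M) (X : M -> 'cV[R]_n) (f : M -> R).

Lemma psi_phi q p : dom (chart_at q) p -> psi q (phi q p) = p.
Proof. exact: fwdK. Qed.

Lemma smooth_fun_differentiable U f q p :
  smooth_fun U f -> U p -> dom (chart_at q) p ->
  differentiable (f \o psi q : 'cV[R]_n -> R^o) (phi q p).
Proof. by move=> /(_ q)[_ /(_ 1%N)[+ _]] Up dp; apply; exists p. Qed.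

Lemma smooth_fun_derive_differentiable U f q p v :
  smooth_fun U f -> U p -> dom (chart_at q) p ->
  differentiable ('D_v (f \o psi q : 'cV[R]_n -> R^o)) (phi q p).
Proof.
by move=> /(_ q)[_ /(_ 2%N)[_ /(_ v)[+ _]]] Up dp; apply; exists p.
Qed.

Lemma smooth_vf_differentiable U X q p :
  smooth_vf U X -> U p -> dom (chart_at q) p ->
  differentiable (vf_rep q X) (phi q p).
Proof. by move=> /(_ q)[_ /(_ 1%N)[+ _]] Up dp; apply; exists p. Qed.

(** Change of charts: near the point p, the function f read in the chart of
index p is f read in the chart of index q composed with the transition map,
whose differential is what tcoord applies to X p; conclude by the chain rule. *)
Lemma vf_app_chart f q p X :
  smooth_fun setT f -> dom (chart_at q) p ->
  vf_app X f p =
  'D_(tcoord q p (X p)) (f \o psi q : 'cV[R]_n -> R^o) (phi q p).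
Proof.
move=> sf dq; have dp := chart_atP p; have [oW sW] := chart_compat p q.
set W := fwd _ @` _ in oW sW; have Wp : W (phi p p) by exists p.
have dc : differentiable (phi q \o psi p) (phi p p).
  by have [h _] := sW 1%N; exact: h.
have qp : (phi q \o psi p) (phi p p) = phi q p by rewrite /= psi_phi.
have df : differentiable (f \o psi q : 'cV[R]_n -> R^o)
                         ((phi q \o psi p) (phi p p)).
  by rewrite qp; apply: smooth_fun_differentiable sf _ _.
rewrite /vf_app /tcoord.
transitivity ('D_(X p) ((f \o psi q : 'cV[R]_n -> R^o) \o (phi q \o psi p))
                (phi p p)).
  apply: near_eq_derive; apply: filterS (open_nbhs_nbhs (conj oW Wp)).
  by move=> _ [p' [dp' dq'] <-] /=; rewrite -/(phi p p') psi_phi// psi_phi.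
rewrite deriveE; last exact: differentiable_comp.
by rewrite diff_comp//= -deriveE// -qp -deriveE.
Qed.

Lemma vf_app_near f U q X :
  smooth_fun setT f -> smooth_vf U X -> U q ->
  \forall x \near phi q q, vf_app X f (psi q x) =
    \sum_i vf_rep q X x i ord0 *
           'D_(delta_mx i ord0) (f \o psi q : 'cV[R]_n -> R^o) x.
Proof.
move=> sf /(_ q)[oW _] Uq.
have Wq : (phi q @` (U `&` dom (chart_at q))) (phi q q).
  by exists q => //; split => //; exact: chart_atP.
apply: filterS (open_nbhs_nbhs (conj oW Wq)) => _ [p [Up dp] <-].
rewrite psi_phi// (vf_app_chart _ sf dp) derive_sum_delta//; last first.
  exact: smooth_fun_differentiable sf _ _.
by rewrite /vf_rep psi_phi.
Qed.

Lemma vf_app_differentiable f U q X :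
  smooth_fun setT f -> smooth_vf U X -> U q ->
  differentiable (vf_app X f \o psi q : 'cV[R]_n -> R^o) (phi q q).
Proof.
move=> sf sX Uq; have dq := chart_atP q.
have : \forall x \near phi q q,
   (\sum_i ((fun x => vf_rep q X x i ord0) : 'cV[R]_n -> R^o) *
           'D_(delta_mx i ord0) (f \o psi q : 'cV[R]_n -> R^o)) x
   = (vf_app X f \o psi q) x.
  apply: filterS (vf_app_near sf sX Uq) => x /= ->.
  by rewrite fct_sumE; apply: eq_bigr.
move/near_eq_differentiable; apply.
apply: differentiable_sum => i; apply: differentiableM.
  apply: (@differentiable_comp _ _ _ _ (vf_rep q X) (fun v => v i ord0)).
    exact: smooth_vf_differentiable sX _ _.
  exact: differentiable_coord.
exact: smooth_fun_derive_differentiable sf _ _.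
Qed.

Lemma vf_app_lincomb m p (c : 'I_m -> R) (X : 'I_m -> M -> 'cV[R]_n) f :
  differentiable (f \o psi p : 'cV[R]_n -> R^o) (phi p p) ->
  vf_app (fun q => \sum_j c j *: X j q) f p = \sum_j c j * vf_app (X j) f p.
Proof. by move=> df; rewrite /vf_app derive_lincomb. Qed.

End VectorFields.

(** * Contractions with an orthogonal matrix *)

(** The left-hand side is the trace of h B h^T. *)
Lemma sum_orthogonal (R : comNzRingType) k (h B : 'M[R]_k) :
  h^T *m h = 1%:M ->
  \sum_i \sum_j h i j * (\sum_l h i l * B l j) = \sum_i B i i.
Proof.
move=> hh; transitivity (\tr (h *m B *m h^T)).
  apply: eq_bigr => i _; rewrite mxE; apply: eq_bigr => j _.
  by rewrite !mxE mulrC.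
by rewrite mxtrace_mulC mulmxA hh mul1mx.
Qed.

(** The summand of index a is the scalar (h G_a)^T (h B_a x). *)
Lemma sum_drift (R : comNzRingType) k d (h : 'M[R]_k) (G : 'I_d -> 'cV[R]_k)
    (B : 'I_d -> 'M[R]_k) (x : 'I_k -> R) :
  h^T *m h = 1%:M ->
  \sum_i \sum_j (\sum_a (h *m G a) i ord0 *: (h *m B a)) i j * x j =
  \sum_a ((G a)^T *m B a *m \col_j x j) ord0 ord0.
Proof.
move=> hh.
transitivity (\sum_i \sum_a
    (h *m G a)^T ord0 i * (h *m B a *m \col_j x j) i ord0).
  apply: eq_bigr => i _.
  rewrite (eq_bigr
    (fun j => \sum_a (h *m G a) i ord0 * ((h *m B a) i j * x j))).
    rewrite exchange_big; apply: eq_bigr => a _ /=.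
    rewrite -mulr_sumr [in RHS]mxE; congr (_ * _).
    by rewrite mxE; apply: eq_bigr => j _; rewrite [in RHS](mxE _ _ j).
  move=> j _; rewrite summxE mulr_suml.
  by apply: eq_bigr => a _; rewrite mxE mulrA.
rewrite exchange_big; apply: eq_bigr => a _ /=.
transitivity (((h *m G a)^T *m (h *m B a *m \col_j x j)) ord0 ord0).
  by rewrite [in RHS]mxE.
by rewrite trmx_mul -!mulmxA (mulmxA h^T) hh mul1mx.
Qed.

Lemma symgroup1_orthogonal (R : realType) k r (nn : gradedLie R k r) h :
  symgroup1 nn h -> h^T *m h = 1%:M.
Proof. by move=> [F [[_ _ _ ?] ->]]. Qed.

Lemma symgroup1_1 (R : realType) k r (nn : gradedLie R k r) :
  symgroup1 nn 1%:M.
Proof.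
have u1 : ulsubmx (1%:M : 'M[R]_(k + r)) = 1%:M.
  by apply/matrixP => i j; rewrite !mxE (inj_eq (@lshift_inj _ _)).
exists 1%:M; split; last by rewrite u1.
split.
- exact: unitmx1.
- by move=> l x; rewrite mul1mx.
- by move=> x y; rewrite !mul1mx.
- by rewrite u1 trmx1 mulmx1.
Qed.

(** * The generator of the development *)

Section Development.
Variables (R : realType) (k r : nat) (M : subRiemannian R k r).
Local Notation n := (k + r)%N.

(** Functions of this form, linear in the matrix variable, are those which
arise from a first application of the fields of the development. *)
Lemma product_app_sum (Z : product_field M) (G : 'I_k -> M -> R) i q h :
  (forall j, differentiable (G j \o psi q : 'cV[R]_n -> R^o) (phi q q)) ->
  product_app Z (fun z => \sum_j z.2 i j * G j z.1) (q, h) =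
  \sum_j ((Z (q, h)).2 i j * G j q +
          h i j * vf_app (fun=> (Z (q, h)).1) (G j) q).
Proof.
move=> dG; rewrite /product_app /=; case: (Z (q, h)) => v w /=.
pose F j : 'cV[R]_n * 'M[R]_k -> R^o :=
  (((fun m : 'M[R]_k => m i j : R^o) \o snd) : _ -> R^o) *
  (((G j \o psi q : 'cV[R]_n -> R^o)) \o fst).
have FE : (fun y : 'cV[R]_n * 'M[R]_k =>
             \sum_j y.2 i j * G j (psi q y.1) : R^o) = \sum_j F j.
  by apply/funext => y; rewrite fct_sumE.
rewrite FE => {FE}.
have dF j : is_derive ((phi q q, h) : 'cV[R]_n * 'M[R]_k) (v, w) (F j)
   (h i j *: vf_app (fun _ => v) (G j) q + G j q *: w i j).
  have dw := is_derive_coord h w i j.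
  have d1 := is_derive_snd (phi q q) v (@ex_derive _ _ _ _ _ _ _ dw).
  have d2 := is_derive_fst h w (diff_derivable (v := v) (dG j)).
  rewrite (@derive_val _ _ _ _ _ _ _ dw) in d1.
  have := is_deriveM d1 d2.
  by rewrite /= psi_phi//; exact: chart_atP.
rewrite derive_sum; last by move=> j; have [] := dF j.
apply: eq_bigr => j _; rewrite (@derive_val _ _ _ _ _ _ _ (dF j)) addrC.
by rewrite [G j q *: _]mulrC.
Qed.

Variables (d : nat) (A : 'I_d -> 'M[R]_n) (s : M -> 'M[R]_(n, k)).
Variable Gam : 'I_d -> 'I_n -> M -> R.

Lemma development_sde_app i (f : M -> R) :
  smooth_fun setT f ->
  product_app (development_sde A s Gam i) (f \o fst) =
  fun z => \sum_j z.2 i j * vf_app (frame_of s j) f z.1.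
Proof.
move=> sf; apply/funext => z.
(* The direction and the function split along the product, so the derivative
   on the product is by definition a derivative on the base. *)
transitivity ('D_(\sum_j z.2 i j *: frame_of s j z.1)
                (f \o psi z.1 : 'cV[R]_n -> R^o) (phi z.1 z.1)); first by [].
rewrite derive_lincomb//.
by apply: (smooth_fun_differentiable sf) => //; exact: chart_atP.
Qed.

Lemma sde_generator_development (U : set M) (f : M -> R) q h :
  (forall i, smooth_vf U (frame_of s i)) -> smooth_fun setT f -> U q ->
  h^T *m h = 1%:M ->
  sde_generator (development_sde A s Gam) (f \o fst) (q, h) =
  2^-1 * (\sum_i vf_app (frame_of s i) (vf_app (frame_of s i) f) q +
     \sum_a ((reduced Gam a q)^T *m ulsubmx (A a) *m
                   \col_j vf_app (frame_of s j) f q) ord0 ord0).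
Proof.
move=> sX sf Uq hh; rewrite /sde_generator; congr (_ * _).
have dG j : differentiable
    (vf_app (frame_of s j) f \o psi q : 'cV[R]_n -> R^o) (phi q q).
  exact: vf_app_differentiable sf (sX j) Uq.
pose B := \matrix_(l, j) vf_app (frame_of s l) (vf_app (frame_of s j) f) q.
transitivity (\sum_i B i i + \sum_a ((reduced Gam a q)^T *m ulsubmx (A a) *m
    \col_j vf_app (frame_of s j) f q) ord0 ord0); last first.
  by congr (_ + _); apply: eq_bigr => i _; rewrite mxE.
rewrite -(sum_orthogonal _ hh) -(sum_drift _ _ _ hh) addrC -big_split.
apply: eq_bigr => i _ /=.
rewrite development_sde_app//.
rewrite (product_app_sum (G := fun j => vf_app (frame_of s j) f) _ _ _ dG).
rewrite -big_split; apply: eq_bigr => j _ /=; congr (_ + _ * _).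
rewrite vf_app_lincomb//.
by apply: eq_bigr => l _; rewrite mxE.
Qed.

End Development.

Theorem theorem1p1 (R : realType) (k r d : nat)
    (M : subRiemannian R k r) (nn : gradedLie R k r)
    (omega : oneform M) (A : 'I_d -> 'M[R]_(k + r))
    (U : set M) (s : M -> 'M[R]_(k + r, k))
    (Gam : 'I_d -> 'I_(k + r) -> M -> R)
    (Delta : (M -> R) -> M -> R) :
  equinilpotentisable M nn ->
  cartan_connection nn omega ->
  adapted nn omega ->
  symalg_basis nn A ->
  local_section nn U s ->
  christoffel A omega U s Gam ->
  development_generator nn A U s Gam (fun f q => 2^-1 * Delta f q) <->
  (forall f, smooth_fun setT f -> forall q, U q ->
     Delta f q =
     \sum_(i < k) vf_app (frame_of s i) (vf_app (frame_of s i) f) q +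
     \sum_(a < d) ((reduced Gam a q)^T *m ulsubmx (A a) *m
                   \col_j vf_app (frame_of s j) f q) ord0 ord0).
Proof.
move=> _ _ _ _ [_ _ sX] _; split=> [gen f sf q Uq | DeltaE f sf q h Uq Hh].
  have n2 : (2^-1 : R) != 0 by rewrite invr_eq0 pnatr_eq0.
  apply: (mulfI n2); rewrite -(gen f sf q 1%:M Uq (symgroup1_1 nn)).
  by apply: (sde_generator_development _ _ sX) => //; rewrite trmx1 mulmx1.
rewrite DeltaE//; apply: (sde_generator_development _ _ sX) => //.
exact: symgroup1_orthogonal Hh.
Qed.
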